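(* Let $k\ge1$, let $Q\in\mathbb{R}^{d\times d}$ be skew-symmetric, $M\in\mathbb{R}^{d\times d}$ symmetric, $A=QM$, let $h$ be the step size, and let $U:\mathbb{R}^d\to\mathbb{R}$ be a homogeneous polynomial of degree $k+2$. Let $x_n,x_{n+1},\ldots,x_{n+k}\in\mathbb{R}^d$ satisfy the $k$-step EKahan scheme $$x_{n+k}=e^{khA}x_n+kh\,\phi(khA)\,Q\,\nabla_{\mathrm K}U(x_n,x_{n+1},\ldots,x_{n+k}).$$ Then $$\begin{aligned}H_{n+1}-H_n=&\ \bar U(x_{n+1},x_{n+2},\ldots,x_{n+k-1},x_{n+k},x_{n+k},x_{n+1}-x_n)\\&+\bar U(x_n,x_{n+1},\ldots,x_{n+k-2},x_{n+k-1},x_n,x_{n+k}-x_{n+k-1})\\&-2\,\bar U\Bigl(x_n,x_{n+1},\ldots,x_{n+k-1},x_{n+k},\frac{x_{n+k}-x_n}{k}\Bigr),\end{aligned}$$ where $$H_n=\frac{1}{2k}\sum_{i=0}^{k-1}x_{n+i}^{\mathsf T}Mx_{n+i}+\bar U(x_n,x_{n+1},\ldots,x_{n+k-2},x_{n+k-1},x_n,x_{n+k-1})$$ is the discrete energy at $t=t_n$ ($H_{n+1}$ being obtained by shifting all indices by one), and $\bar U(\cdot,\ldots,\cdot)$ is the symmetric $(k+2)$-linear form associated with $U$, satisfying $\bar U(x,\ldots,x)=U(x)$.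
   Context: $\phi(z)=\frac{e^z-1}{z}$ (entire, $\phi(0)=1$), applied to matrices through its power series. The polarized gradient is $$\nabla_{\mathrm K}U(x_n,\ldots,x_{n+k})=\sum_{\substack{1\le m\le k+1\\ n\le i_1<\cdots<i_m\le n+k}}\frac{(-1)^{k+1-m}}{(k+1)!}\,\nabla U(x_{i_1}+\cdots+x_{i_m}),$$ the symmetric $(k+1)$-linear polarization of $\nabla U$. The underlying system is $\dot x=QMx+Q\nabla U(x)$. In the argument list $(x_n,\ldots,x_{n+k-1},x_n,x_{n+k-1})$ the first $k$ entries are the consecutive points $x_n,\ldots,x_{n+k-1}$; in $(x_{n+1},\ldots,x_{n+k},x_{n+k},x_{n+1}-x_n)$ they are $x_{n+1},\ldots,x_{n+k}$ (in the case $k=1$ these lists consist of a single point). *)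

(* Defs.v *)
From HB Require Import structures.
From mathcomp Require Import all_boot all_order all_algebra perm.
From mathcomp Require Import all_classical all_reals all_analysis.
(* The notations of mpoly clash with those of mathcomp-analysis: only its
   structures are imported. *)
From mathcomp Require mpoly.
Import (canonicals, coercions) mpoly.

Set Implicit Arguments.
Unset Strict Implicit.
Unset Printing Implicit Defensive.

Import Order.TTheory GRing.Theory Num.Theory.
Import numFieldNormedType.Exports.

Local Open Scope classical_set_scope.
Local Open Scope ring_scope.

Definition mxpseries (R : realType) (d : nat) (f : nat -> R) (A : 'M[R]_d)
    : 'M[R]_d :=
  limn (series (fun j => f j *: A ^+ j)).

Definition mxexp (R : realType) (d : nat) (A : 'M[R]_d) : 'M[R]_d :=
  mxpseries (fun j => (j`!%:R)^-1) A.

Definition phi (R : realType) (z : R) : R :=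
  if z == 0 then 1 else (expR z - 1) / z.

Definition phi_coef (R : realType) (j : nat) : R := (j.+1`!%:R)^-1.

Lemma cvg_pseries_phi (R : realType) (z : R) :
  pseries (@phi_coef R) z @ \oo --> phi z.
Proof.
rewrite /phi; case: eqVneq => [->|z0].
  apply: cvg_near_cst; near=> n.
  have [m ->] : exists m, n = m.+1.
    by exists n.-1; rewrite prednK//; near: n; exact: nbhs_infty_gt.
  rewrite /pseries /series /= big_nat_recl// big1 ?addr0.
    by rewrite expr0 mulr1 /phi_coef invr1.
  by move=> i _; rewrite expr0n mulr0.
have -> : pseries (@phi_coef R) z =
    (fun n => (series (exp_coeff z) n.+1 - 1) / z).
  apply/funext => n; rewrite /pseries /series /= big_nat_recl//.
  rewrite /exp_coeff /= expr0 fact0 divr1 [1 + _]addrC addrK mulr_suml.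
  apply: eq_bigr => i _; rewrite /phi_coef exprS [RHS]mulrAC [z * _]mulrC.
  by rewrite mulfK// mulrC.
apply: cvgMr_tmp; apply: cvgB; last exact: cvg_cst.
rewrite (_ : (fun n => _) = (fun n => series (exp_coeff z) (n + 1)%N)); last first.
  by apply/funext => n; rewrite addn1.
by rewrite cvg_shiftn; exact: is_cvg_series_exp_coeff.
Unshelve. all: by end_near. Qed.

(* phi applied to a matrix through the power series of phi, whose coefficients
   are those of [cvg_pseries_phi]. *)
Definition mxphi (R : realType) (d : nat) (A : 'M[R]_d) : 'M[R]_d :=
  mxpseries (@phi_coef R) A.

Definition homogeneous_polynomial (R : realType) (d m : nat)
    (U : 'cV[R]_d -> R) : Prop :=
  exists2 p : mpoly.mpoly d R,
    p \is mpoly.ishomog1 m (@mpoly.mdeg d) &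
    forall x : 'cV[R]_d, U x = mpoly.meval (fun i => x i ord0) p.

Definition gradient (R : realType) (d : nat) (U : 'cV[R]_d -> R)
    (x : 'cV[R]_d) : 'cV[R]_d :=
  \col_i 'D_(delta_mx i ord0) U x.

(* The index sets {i_1 < ... < i_m} are the m-element subsets I of 'I_k.+1,
   with i standing for the index n + i. *)
Definition polarized_gradient (R : realType) (d k : nat) (U : 'cV[R]_d -> R)
    (t : (k.+1).-tuple 'cV[R]_d) : 'cV[R]_d :=
  \sum_(1 <= m < k.+2) \sum_(I : {set 'I_k.+1} | #|I| == m)
    ((-1) ^+ (k.+1 - m) / (k.+1)`!%:R) *: gradient U (\sum_(i in I) tnth t i).

Definition upd_tuple (T : Type) (m : nat) (t : m.-tuple T) (i : 'I_m) (v : T)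
    : m.-tuple T :=
  [tuple if j == i then v else tnth t j | j < m].

Definition multilinear_form (R : realType) (d m : nat)
    (B : m.-tuple 'cV[R]_d -> R) : Prop :=
  forall (t : m.-tuple 'cV[R]_d) (i : 'I_m), scalar (fun v => B (upd_tuple t i v)).

Definition symmetric_form (R : realType) (d m : nat)
    (B : m.-tuple 'cV[R]_d -> R) : Prop :=
  forall (t : m.-tuple 'cV[R]_d) (s : 'S_m),
    B [tuple tnth t (s i) | i < m] = B t.

Definition is_polar_form (R : realType) (d m : nat) (U : 'cV[R]_d -> R)
    (B : m.-tuple 'cV[R]_d -> R) : Prop :=
  [/\ multilinear_form B, symmetric_form B &
      forall x : 'cV[R]_d, B [tuple of nseq m x] = U x].

(* window x n m is the list x_n, ..., x_(n+m-1). *)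
Definition window (T : Type) (x : nat -> T) (n m : nat) : m.-tuple T :=
  [tuple x (n + i)%N | i < m].

Definition append2 (T : Type) (m : nat) (t : m.-tuple T) (a b : T)
    : (m + 2).-tuple T :=
  [tuple of t ++ [tuple a; b]].

Definition ekahan_step (R : realType) (d k : nat) (h : R) (A Q : 'M[R]_d)
    (U : 'cV[R]_d -> R) (x : nat -> 'cV[R]_d) (n : nat) : Prop :=
  x (n + k)%N = mxexp ((k%:R * h) *: A) *m x n
    + (k%:R * h) *: (mxphi ((k%:R * h) *: A) *m Q
                     *m polarized_gradient U (window x n k.+1)).

Definition quad (R : realType) (d : nat) (M : 'M[R]_d) (v : 'cV[R]_d) : R :=
  (v^T *m M *m v) ord0 ord0.

Definition discrete_energy (R : realType) (d k : nat) (M : 'M[R]_d)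
    (Ubar : (k + 2).-tuple 'cV[R]_d -> R) (x : nat -> 'cV[R]_d) (n : nat) : R :=
  (2 * k%:R)^-1 * (\sum_(0 <= i < k) quad M (x (n + i)%N))
    + Ubar (append2 (window x n k) (x n) (x (n + k.-1)%N)).

(* Main.v *)
Require Import Defs.
From HB Require Import structures.
From mathcomp Require Import all_boot all_order all_algebra perm ring lra.
From mathcomp Require Import all_classical all_reals all_analysis.

(** Write [X = x_n], [Y = x_(n+k)], [t = k h], [Z = t Q M], and let [G] be the
    polarized gradient at [x_n, ..., x_(n+k)].  Two facts carry the theorem.

    Energy balance of one step ([exponential_step_energy]): the step
    [Y = e^Z X + t phi(Z) Q G] satisfies
      [Y^T M Y - X^T M X = - 2 G^T (Y - X)].
    The textbook argument completes the square with [M^-1 G]; as [M] may be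
    singular, the inhomogeneity is absorbed in one extra dimension instead.
    With [B = (0 0; t Q G, Z)] and [S = (0 G^T; G M)] one has
    [e^B (1; X) = (1; Y)] ([exp_series_block]), the vector [(1; y)] has
    [S]-energy [y^T M y + 2 G^T y] ([block_energy]), and [B^T S = - S B] because
    [Q] is skew and [M] symmetric ([block_adjoint]).  The last identity gives
    [(e^B)^T S e^B = S e^(-B) e^B = S], so the [S]-energies of [(1; X)] and
    [(1; Y)] agree.  The identity [e^(-B) e^B = 1] is
    [cvg_exp_seriesNM].

    Polarization ([polarized_gradient_polar]): for every [v],
      [G^T v = (k + 2) Ubar(x_n, ..., x_(n+k), v)].
    The derivative of [U] at [x] along [v] is [(k + 2) Ubar(x, ..., x, v)]
    ([derive_polar]), and the alternating sum over subsets in the definition of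
    [G] is the polarization identity of the form [Ubar(., ..., ., v)]
    ([polarization]).

    Together, [Y^T M Y - X^T M X] is [- 2 (k + 2)] times the difference of
    [Ubar(x_n, ..., x_(n+k), Y)] and [Ubar(x_n, ..., x_(n+k), X)].  The quadratic
    parts of [H_n] telescope to this, and the remaining terms match by linearity
    in the last argument and by symmetry of [Ubar]. *)

Set Implicit Arguments.
Unset Strict Implicit.
Unset Printing Implicit Defensive.

Import Order.TTheory GRing.Theory Num.Theory.
Import numFieldNormedType.Exports.

Local Open Scope ring_scope.

(** * Exponential series *)

(** Absolute convergence of matrix series is stated for complete normed modules;
    this joins the completeness and the norm of matrices. *)
HB.instance Definition _ (R : realType) (m n : nat) := Complete.on 'M[R]_(m, n).

(** The square [i, j < N] is the triangle [i + j < N], summed along antidiagonals,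
    and its complement: the finite form of the Cauchy product. *)
Lemma square_sum_split (V : nmodType) (N : nat) (F : nat -> nat -> V) :
  \sum_(0 <= i < N) \sum_(0 <= j < N) F i j =
  \sum_(0 <= m < N) \sum_(0 <= i < m.+1) F i (m - i)%N
  + \sum_(0 <= i < N) \sum_(0 <= j < N | (N <= i + j)%N) F i j.
Proof.
under eq_bigr => i _ do rewrite (bigID (fun j => (N <= i + j)%N)) /= addrC.
rewrite big_split /=; congr (_ + _).
transitivity (\sum_(0 <= i < N) \sum_(0 <= m < N | (i <= m)%N) F i (m - i)%N).
  apply: eq_big_nat => i /andP[_ iN].
  rewrite [RHS](_ : _ = \sum_(i <= m < N) F i (m - i)%N); last first.
    by rewrite [RHS](big_nat_widenl _ 0).
  rewrite -{3}[i]add0n big_addn [RHS](big_nat_widen _ _ N) ?leq_subr//.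
  by apply: eq_big => [j|j _]; rewrite ?addnK// -ltnNge ltn_subRL.
rewrite (exchange_big_dep_nat xpredT) //=; apply: eq_big_nat => m /andP[_ mN].
by rewrite [RHS](big_nat_widen _ _ N).
Qed.

(** The scalar and the matrix series are both instances of this one, which is what
    lets the first bound the second term by term. *)
Definition exp_term (R : numFieldType) (W : algType R) (a : W) (j : nat) : W :=
  (j`!%:R)^-1 *: a ^+ j.

Lemma scalerMM (R : pzRingType) (W : algType R) (u v : R) (a b : W) :
  (u *: a) * (v *: b) = (u * v) *: (a * b).
Proof. by rewrite -scalerAl -scalerAr scalerA. Qed.

Lemma exp_termD (R : numFieldType) (W : algType R) (a b : W) (m : nat) :
  GRing.comm a b ->
  exp_term (a + b) m =
  \sum_(0 <= i < m.+1) exp_term a i * exp_term b (m - i).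
Proof.
move=> cab; rewrite addrC /exp_term exprDn_comm; last exact: commr_sym.
rewrite scaler_sumr big_mkord; apply: eq_bigr => -[i im] _ /=.
rewrite ltnS in im.
rewrite scalerMM -scalerMnr scalerMnl -mulr_natr.
congr (_ *: _).
  have f0 k : k`!%:R != 0 :> R by rewrite pnatr_eq0 -lt0n fact_gt0.
  apply: (mulfI (f0 m)); rewrite mulVKf// -(bin_fact im) 2!natrM -invfM.
  by rewrite mulfK// mulf_neq0.
by apply: commrX; apply: commr_sym; apply: commrX.
Qed.

(** The antidiagonals of the product of two truncated series sum to the series of
    [a + b] by the binomial theorem.  The remainder is kept explicit, to be
    compared with the same remainder for real numbers. *)
Lemma exp_seriesM (R : numFieldType) (W : algType R) (a b : W) (N : nat) :
  GRing.comm a b ->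
  series (exp_term a) N * series (exp_term b) N =
  series (exp_term (a + b)) N
  + \sum_(0 <= i < N) \sum_(0 <= j < N | (N <= i + j)%N)
      exp_term a i * exp_term b j.
Proof.
move=> cab; rewrite /series /= big_distrlr square_sum_split; congr (_ + _).
by apply: eq_bigr => m _; rewrite exp_termD.
Qed.

Section matrix_exponential.
Local Open Scope classical_set_scope.
Variables (R : realType) (n : nat).
Implicit Types Z A B : 'M[R]_n.

Lemma normmxM m p q (A : 'M[R]_(m, p)) (B : 'M[R]_(p, q)) :
  `|A *m B| <= p%:R * `|A| * `|B|.
Proof.
rewrite [leLHS]mx_normrE; apply/bigmax_leP; split.
  by rewrite !mulr_ge0.
move=> -[i j] _ /=; rewrite mxE (le_trans (ler_norm_sum _ _ _))//.
rewrite (@le_trans _ _ (\sum_(k < p) `|A| * `|B|))//; last first.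
  by rewrite sumr_const card_ord -mulrA mulr_natl.
have le_entry r s (C : 'M[R]_(r, s)) u v : `|C u v| <= `|C|.
  rewrite [leRHS]mx_normrE.
  exact: (le_bigmax _ (fun ij : 'I_r * 'I_s => `|C ij.1 ij.2|) (u, v)).
by apply: ler_sum => k _; rewrite normrM ler_pM.
Qed.

Lemma norm_expmx Z j : `|Z ^+ j| <= (n%:R * `|Z|) ^+ j.
Proof.
elim: j => [|j IH].
  rewrite !expr0 [leLHS]mx_normrE; apply/bigmax_leP; split=> // -[i k] _ /=.
  by rewrite mxE; case: (i == k); rewrite /= ?normr1 ?normr0.
rewrite exprS [leRHS]exprS (le_trans (normmxM _ _))//.
by rewrite ler_wpM2l// mulr_ge0.
Qed.

Lemma is_cvg_mxpseries (f : nat -> R) Z :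
  (forall j, `|f j| <= (j`!%:R)^-1) ->
  cvgn (series (fun j => f j *: Z ^+ j)).
Proof.
move=> fle; apply: normed_cvg.
apply: (@series_le_cvg _ _ (exp_coeff (n%:R * `|Z|))) => [j|j|j|].
- exact: normr_ge0.
- by rewrite /exp_coeff divr_ge0// exprn_ge0// mulr_ge0.
- by rewrite /exp_coeff /= mx_normZ mulrC ler_pM// norm_expmx.
- exact: is_cvg_series_exp_coeff.
Qed.

End matrix_exponential.

Section matrix_limits.
Local Open Scope classical_set_scope.
Variable R : realType.

Lemma cvg_mxP m p (F : nat -> 'M[R]_(m, p)) (L : 'M[R]_(m, p)) :
  (forall i j, F n i j @[n --> \oo] --> L i j) -> F n @[n --> \oo] --> L.
Proof.
move=> FL; apply/cvg_mx_entourageP => A entA.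
have Fij (ij : 'I_m * 'I_p) :
    \forall n \near \oo, (L ij.1 ij.2, F n ij.1 ij.2) \in A.
  have H : \forall n \near \oo, xsection A (L ij.1 ij.2) (F n ij.1 ij.2).
    exact: (FL ij.1 ij.2 _ (nbhs_entourage _ entA)).
  by apply: filterS H => n /xsectionP/mem_set.
by apply: filterS (filter_forall _ Fij) => n An i j; exact: (An (i, j)).
Qed.

Lemma cvg_mx_coord m p (F : nat -> 'M[R]_(m, p)) (L : 'M[R]_(m, p)) i j :
  F n @[n --> \oo] --> L -> F n i j @[n --> \oo] --> L i j.
Proof.
move=> FL.
apply: (@continuous_cvg _ _ _ _ _ _ (fun M : 'M[R]_(m, p) => M i j)) => //.
exact: coord_continuous.
Qed.

Lemma cvg_mulmx m p q (F : nat -> 'M[R]_(m, p)) (G : nat -> 'M[R]_(p, q))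
    (A : 'M[R]_(m, p)) (B : 'M[R]_(p, q)) :
  F n @[n --> \oo] --> A -> G n @[n --> \oo] --> B ->
  F n *m G n @[n --> \oo] --> A *m B.
Proof.
move=> FA GB; apply: cvg_mxP => i j; rewrite mxE.
under eq_fun do rewrite mxE.
apply: cvg_big => [|k _]; [exact: add_continuous|].
by apply: cvgM; exact: cvg_mx_coord.
Qed.

Lemma cvg_trmx m p (F : nat -> 'M[R]_(m, p)) (A : 'M[R]_(m, p)) :
  F n @[n --> \oo] --> A -> (F n)^T @[n --> \oo] --> A^T.
Proof.
move=> FA; apply: cvg_mxP => i j; rewrite mxE; under eq_fun do rewrite mxE.
exact: cvg_mx_coord.
Qed.

End matrix_limits.

Section exp_inverse.
Local Open Scope classical_set_scope.
Variables (R : realType) (n : nat).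
Implicit Types Z : 'M[R]_n.+1.

(** The remainder of [exp_seriesM] at [- Z] and [Z] is dominated term by term by
    the remainder at the real numbers [c] and [c], [c] bounding [Z]
    multiplicatively; by [exp_seriesM] again, that one is a difference of
    scalar partial sums. *)
Lemma norm_exp_seriesM_tail Z N :
  `|series (exp_term (- Z)) N.+1 * series (exp_term Z) N.+1 - 1| <=
  series (exp_coeff (n.+1%:R * `|Z|)) N.+1
    * series (exp_coeff (n.+1%:R * `|Z|)) N.+1
  - series (exp_coeff (n.+1%:R * `|Z| *+ 2)) N.+1.
Proof.
set c := n.+1%:R * `|Z|.
have c0 : 0 <= c by rewrite mulr_ge0.
have exp_coeffE (z : R) : exp_coeff z = exp_term (z : R^o).
  by apply/funext => j; rewrite /exp_coeff /exp_term /= mulrC.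
rewrite exp_seriesM; last exact/commr_sym/commrN.
have -> : series (exp_term (- Z + Z)) N.+1 = 1.
  rewrite addNr /series /= big_nat_recl// big1 => [|j _].
    by rewrite /exp_term invr1 scale1r addr0.
  by rewrite /exp_term expr0n scaler0.
rewrite addrC addKr !exp_coeffE (@exp_seriesM _ R^o)//.
rewrite -mulr2n addrC addKr.
apply: (le_trans (ler_norm_sum _ _ _)); apply: ler_sum => i _.
apply: (le_trans (ler_norm_sum _ _ _)); apply: ler_sum => j _.
rewrite /exp_term !scalerMM mx_normZ ger0_norm; last by rewrite mulr_ge0.
rewrite -exprD [leRHS]/(_ * _) ler_wpM2l ?mulr_ge0//.
rewrite exprNn -mulrA -exprD -signr_odd mulr_sign.
by case: (odd i); rewrite ?normrN; exact: norm_expmx.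
Qed.

(** The scalar bound of [norm_exp_seriesM_tail] tends to
    [expR c * expR c - expR (2 c) = 0]. *)
Lemma cvg_exp_seriesNM Z :
  series (exp_term (- Z)) N * series (exp_term Z) N @[N --> \oo]
    --> (1 : 'M[R]_n.+1).
Proof.
set c := n.+1%:R * `|Z|.
have es z : series (exp_coeff z) N @[N --> \oo] --> expR z.
  exact: is_cvg_series_exp_coeff.
have tail0 : series (exp_coeff c) N * series (exp_coeff c) N
    - series (exp_coeff (c *+ 2)) N @[N --> \oo] --> (0 : R).
  have <- : expR c * expR c - expR (c *+ 2) = 0 by rewrite mulr2n expRD subrr.
  by apply: cvgB; [apply: cvgM|]; exact: es.
rewrite -cvg_shiftS; apply/subr_cvg0; apply: norm_cvg0.
rewrite -cvg_shiftS in tail0.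
apply: squeeze_cvgr (cvg_cst (0 : R)) tail0.
by apply: nearW => N; rewrite normr_ge0 norm_exp_seriesM_tail.
Qed.

(** If [Z] is skew for the bilinear form [M], transposition moves a power series
    in [Z] across [M] as the series in [- Z]. *)
Lemma exp_series_adjoint Z (M : 'M[R]_n.+1) N : Z^T *m M = - (M *m Z) ->
  (series (exp_term Z) N)^T *m M = M *m series (exp_term (- Z)) N.
Proof.
move=> adjZ.
have adjX j : (Z ^+ j)^T *m M = M *m (- Z) ^+ j.
  elim: j => [|j IH]; first by rewrite !expr0 trmx1 mul1mx mulmx1.
  rewrite exprS exprSr trmx_mul -mulmxA adjZ mulmxN mulmxA IH.
  by rewrite -mulmxN -mulmxA.
have adjS c X Y : X^T *m M = M *m Y -> (c *: X)^T *m M = M *m (c *: Y).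
  by rewrite -scalemxAr => <-; rewrite linearZ -scalemxAl.
rewrite /series /= raddf_sum mulmx_suml mulmx_sumr; apply: eq_bigr => j _.
exact: adjS.
Qed.

Lemma cvg_exp_series_invariant Z (M : 'M[R]_n.+1) : Z^T *m M = - (M *m Z) ->
  (series (exp_term Z) N)^T *m M *m series (exp_term Z) N @[N --> \oo] --> M.
Proof.
move=> adjZ; under eq_fun do rewrite exp_series_adjoint// -mulmxA.
have := cvg_mulmx (cvg_cst M) (@cvg_exp_seriesNM Z).
have -> : M *m (1 : 'M[R]_n.+1) = M by exact: mulmx1.
by apply.
Qed.

End exp_inverse.

(** * Energy balance of an exponential step *)

Section energy.
Local Open Scope classical_set_scope.
Variables (R : realType) (d : nat).

(** The [j+1]-st power of [B = (0 0; g, Z)] sends [(1; X)] to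
    [(0; Z^j g + Z^(j+1) X)].  Dividing by [(j+1)!] turns the coefficients of [g]
    into those of [phi], hence the shift by one between the two truncations. *)
Lemma exp_series_block (Z : 'M[R]_d) (X g : 'cV[R]_d) (N : nat) :
  series (exp_term (block_mx 0 0 g Z : 'M[R]_(1 + d))) N.+1
    *m col_mx 1%:M X =
  col_mx (1%:M : 'M[R]_1)
    (series (fun j => (j`!%:R)^-1 *: Z ^+ j) N.+1 *m X
     + series (fun j => phi_coef R j *: Z ^+ j) N *m g).
Proof.
set B := (block_mx _ _ _ _ : 'M[R]_(1 + d)).
have ZS j : Z *m Z ^+ j = Z ^+ j.+1 by rewrite exprS.
have powB j : B ^+ j.+1 *m col_mx 1%:M X =
    col_mx 0 (Z ^+ j *m g + Z ^+ j.+1 *m X).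
  elim: j => [|j IH].
    by rewrite expr1 mul_block_col !mul0mx addr0 mulmx1 expr0 mul1mx expr1.
  rewrite exprS -mulmxA IH mul_block_col !mul0mx mulmx0 !add0r mulmxDr !mulmxA.
  by rewrite !ZS.
rewrite /series /=; elim: N => [|N IH].
  rewrite !big_nat1 big_geq// mul0mx addr0 /exp_term invr1 !scale1r !expr0.
  by rewrite !mul1mx.
have termB : (exp_term B N.+1 : 'M[R]_(1 + d)) *m col_mx 1%:M X =
    col_mx (0 : 'cV[R]_1)
      ((N.+1`!%:R)^-1 *: Z ^+ N.+1 *m X + phi_coef R N *: Z ^+ N *m g).
  have -> : (exp_term B N.+1 : 'M[R]_(1 + d)) *m col_mx 1%:M X =
      (N.+1`!%:R)^-1 *: (B ^+ N.+1 *m col_mx 1%:M X) by rewrite scalemxAl.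
  by rewrite powB scale_col_mx scaler0 scalerDr !scalemxAl addrC.
rewrite big_nat_recr// mulmxDl IH termB.
apply: etrans (@add_col_mx R 1 d 1 _ _ _ _) _.
rewrite addr0; congr col_mx.
rewrite [in RHS]big_nat_recr// mulmxDl; rewrite -!addrA; congr (_ + _).
by rewrite addrCA [in RHS]big_nat_recr// mulmxDl.
Qed.

Lemma block_energy (M : 'M[R]_d) (G y : 'cV[R]_d) :
  (col_mx 1%:M y)^T *m block_mx 0 G^T G M *m col_mx (1%:M : 'M[R]_1) y =
  G^T *m y + y^T *m G + y^T *m M *m y.
Proof.
rewrite tr_col_mx trmx1 mul_row_block mul_row_col !mul1mx mulmx1 add0r.
by rewrite mulmxDl addrA [y^T *m G + _]addrC.
Qed.

Lemma block_adjoint (t : R) (Q M : 'M[R]_d) (G : 'cV[R]_d) :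
  Q^T = - Q -> M^T = M ->
  let B : 'M[R]_(1 + d) := block_mx 0 0 (t *: (Q *m G)) (t *: (Q *m M)) in
  let S : 'M[R]_(1 + d) := block_mx 0 G^T G M in
  B^T *m S = - (S *m B).
Proof.
move=> hQ hM B S; rewrite /B /S tr_block_mx !mulmx_block opp_block_mx.
have trmxZ m p (A : 'M[R]_(m, p)) : (t *: A)^T = t *: A^T by rewrite linearZ.
rewrite !trmx0 !mul0mx !mulmx0 !add0r ?addr0 !trmxZ !trmx_mul hQ hM.
by rewrite -!scalemxAl -!scalemxAr !mulmxN !mulNmx !mulmxA !scalerN.
Qed.

Lemma cvg_mxexp (Z : 'M[R]_d) :
  series (fun j => (j`!%:R)^-1 *: Z ^+ j) N @[N --> \oo] --> mxexp Z.
Proof. by apply: is_cvg_mxpseries => j; rewrite ger0_norm. Qed.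

Lemma cvg_mxphi (Z : 'M[R]_d) :
  series (fun j => phi_coef R j *: Z ^+ j) N @[N --> \oo] --> mxphi Z.
Proof.
apply: is_cvg_mxpseries => j; rewrite /phi_coef ger0_norm ?invr_ge0//.
by rewrite lef_pV2 ?posrE ?ltr0n ?fact_gt0// ler_nat factS leq_pmull.
Qed.

(** The [S]-energy of [e^B (1; X)] is computed twice, as a limit along partial
    sums: through [exp_series_block] it tends to the energy of [Y], through
    invariance of [S] to that of [X]. *)
Lemma exponential_step_energy (t : R) (Q M : 'M[R]_d) (X G : 'cV[R]_d) :
  Q^T = - Q -> M^T = M ->
  let Z := t *: (Q *m M) in
  let Y := mxexp Z *m X + t *: (mxphi Z *m Q *m G) in
  quad M Y + 2 * (G^T *m Y) ord0 ord0 = quad M X + 2 * (G^T *m X) ord0 ord0.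
Proof.
move=> hQ hM Z Y.
pose E y := G^T *m y + y^T *m G + y^T *m M *m y.
have quadE y : quad M y + 2 * (G^T *m y) ord0 ord0 = E y ord0 ord0.
  have addE (a b c : 'M[R]_1) :
    (a + b + c) ord0 ord0 = a ord0 ord0 + b ord0 ord0 + c ord0 ord0.
    by rewrite !mxE.
  have trE : (y^T *m G) ord0 ord0 = (G^T *m y) ord0 ord0.
    by rewrite -[G^T *m y]trmxK trmx_mul trmxK [RHS]mxE.
  by rewrite /E addE trE -mulr2n mulr_natl addrC.
rewrite !quadE; congr (fun_of_matrix _ _ _).
pose y N := series (fun j => (j`!%:R)^-1 *: Z ^+ j) N.+1 *m X
     + series (fun j => phi_coef R j *: Z ^+ j) N *m (t *: (Q *m G)).
have yY : y N @[N --> \oo] --> Y.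
  rewrite /Y -mulmxA scalemxAr; apply: cvgD; apply: cvg_mulmx.
  - by rewrite (cvg_shiftS (series _)); exact: cvg_mxexp.
  - exact: cvg_cst.
  - exact: cvg_mxphi.
  - exact: cvg_cst.
have EyY : E (y N) @[N --> \oo] --> E Y.
  have yT := cvg_trmx yY.
  apply: cvgD; [apply: cvgD|]; repeat (apply: cvg_mulmx => //); exact: cvg_cst.
suff EyX : E (y N) @[N --> \oo] --> E X.
  by apply: (cvg_unique _ EyY EyX).
pose w : 'cV[R]_(1 + d) := col_mx 1%:M X.
pose B : 'M[R]_(1 + d) := block_mx 0 0 (t *: (Q *m G)) Z.
pose S : 'M[R]_(1 + d) := block_mx 0 G^T G M.
have EyE N : E (y N) = w^T *m
   ((series (exp_term B) N.+1)^T *m S *m series (exp_term B) N.+1) *m w.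
  have -> : E (y N) = (series (exp_term B) N.+1 *m w)^T *m S
      *m (series (exp_term B) N.+1 *m w).
    by rewrite exp_series_block block_energy.
  by rewrite trmx_mul !mulmxA.
under eq_fun do rewrite EyE.
rewrite -[E X]block_energy.
apply: cvg_mulmx; last exact: cvg_cst.
apply: cvg_mulmx; first exact: cvg_cst.
have := @cvg_exp_series_invariant R d B S (block_adjoint _ _ hQ hM).
by rewrite -cvg_shiftS; apply.
Qed.

End energy.

(** * Multilinear forms: expansion and derivative *)

Section multilinear.
Variables (R : realType) (d m : nat) (B : m.-tuple 'cV[R]_d -> R).
Local Notation V := 'cV[R]_d.
Hypothesis mB : multilinear_form B.

Lemma multilinear_sum (t : m.-tuple V) (i : 'I_m) (J : Type) (r : seq J)
    (P : pred J) (v : J -> V) :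
  B (upd_tuple t i (\sum_(j <- r | P j) v j)) =
  \sum_(j <- r | P j) B (upd_tuple t i (v j)).
Proof.
pose f v := B (upd_tuple t i v).
pose L : {scalar V} := HB.pack f (GRing.isLinear.Build R V R _ f (mB t i)).
exact: (linear_sum L).
Qed.

Lemma multilinearPZ (t : m.-tuple V) (i : 'I_m) (c : R) (u v : V) :
  B (upd_tuple t i (u + c *: v)) =
  B (upd_tuple t i u) + c * B (upd_tuple t i v).
Proof. by rewrite addrC (mB t i c v u) addrC. Qed.

Lemma multilinearZ (t : m.-tuple V) (i : 'I_m) (c : R) (v : V) :
  B (upd_tuple t i (c *: v)) = c * B (upd_tuple t i v).
Proof.
have B0 : B (upd_tuple t i 0) = 0.
  have := multilinear_sum t i [::] xpredT (fun _ : nat => 0).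
  by rewrite !big_nil.
by have := multilinearPZ t i c 0 v; rewrite add0r B0 add0r.
Qed.

Lemma mktuple_upd (y : 'I_m -> V) (i : 'I_m) (v : V) :
  upd_tuple [tuple y j | j < m] i v = [tuple if j == i then v else y j | j < m].
Proof. by apply: eq_mktuple => j; rewrite tnth_mktuple. Qed.

(** Induction on the set [r] of slots that hold the sum, the others being frozen
    at a choice [z]: linearity in one more slot sums over the value that a choice
    function takes there, and the frozen choice is updated accordingly. *)
Lemma multilinear_expansion (T : finType) (k0 : T) (P : pred T) (v : T -> V) :
  B [tuple \sum_(k | P k) v k | _ < m] =
  \sum_(f : {ffun 'I_m -> T} | [forall j, P (f j)]) B [tuple v (f j) | j < m].
Proof.
set s := \sum_(k | P k) v k.
suff expand (r : seq 'I_m) (z : 'I_m -> T) : uniq r ->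
    B [tuple if j \in r then s else v (z j) | j < m] =
    \sum_(f : {ffun 'I_m -> T} |
            [forall j, if j \in r then P (f j) else f j == z j])
       B [tuple v (f j) | j < m].
  transitivity (B [tuple if j \in enum 'I_m then s else v k0 | j < m]).
    by congr B; apply: eq_mktuple => j; rewrite mem_enum.
  rewrite (expand _ (fun=> k0)) ?enum_uniq//; apply: eq_bigl => f.
  by apply: eq_forallb => j; rewrite mem_enum.
elim: r z => [|i r IH] z /=.
  move=> _; rewrite (big_pred1 [ffun j => z j]) => [|f] /=.
    by congr B; apply: eq_mktuple => j; rewrite ffunE.
  apply/forallP/eqP => [fz|-> j]; last by rewrite ffunE.
  by apply/ffunP => j; rewrite ffunE; apply/eqP/fz.
move=> /andP[ir ur].
transitivity (B (upd_tuple [tuple if j \in r then s else v (z j) | j < m] i s)).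
  rewrite mktuple_upd; congr B; apply: eq_mktuple => j.
  by rewrite in_cons; case: eqP.
rewrite multilinear_sum.
rewrite [RHS](partition_big (fun f : {ffun 'I_m -> T} => f i) P) /=; last first.
  by move=> f /forallP/(_ i); rewrite in_cons eqxx.
apply: eq_bigr => k Pk.
rewrite mktuple_upd.
transitivity (B [tuple if j \in r then s
                       else v (if j == i then k else z j) | j < m]).
  congr B; apply: eq_mktuple => j.
  by case: (eqVneq j i) => // ->; rewrite (negbTE ir).
rewrite (IH (fun j => if j == i then k else z j) ur); apply: eq_bigl => f.
apply/forallP/andP => [Pf|[/forallP Pf /eqP fi] j].
  split; last by have := Pf i; rewrite (negbTE ir) eqxx.
  apply/forallP => j; have := Pf j; rewrite in_cons.
  case: (eqVneq j i) => //= ->.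
  by rewrite (negbTE ir) => /eqP ->.
have := Pf j; rewrite in_cons; case: (eqVneq j i) => //= ->.
by rewrite (negbTE ir) fi.
Qed.

(** Leibniz rule along a line, by induction on the set [r] of moving slots:
    linearity in a moving slot [i] writes the form as [g x + s * g v], where [g u]
    has [u] in slot [i] and fewer moving slots. *)
Lemma multilinear_is_derive (x v : V) (r : seq 'I_m) (c : 'I_m -> V) : uniq r ->
  is_derive (0 : R) 1
    (fun s => B [tuple if j \in r then x + s *: v else c j | j < m])
    (\sum_(i <- r) B [tuple if j == i then v else
                            if j \in r then x else c j | j < m]).
Proof.
elim: r c => [|i r IH] c /=.
  move=> _; rewrite big_nil; exact: is_derive_cst.
move=> /andP[ir ur].
pose cu (u : V) j := if j == i then u else c j.
pose g u s := B [tuple if j \in r then x + s *: v else cu u j | j < m].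
have updE u s : upd_tuple [tuple if j \in r then x + s *: v else c j | j < m] i u
    = [tuple if j \in r then x + s *: v else cu u j | j < m].
  rewrite mktuple_upd; apply: eq_mktuple => j; rewrite /cu.
  by case: (eqVneq j i) => // ->; rewrite (negbTE ir).
have -> : (fun s => B [tuple if j \in i :: r then x + s *: v else c j | j < m])
    = g x + id * g v.
  apply/funext => s; rewrite /g -[RHS]/(_ + s * _) -!updE -multilinearPZ.
  rewrite mktuple_upd; congr B; apply: eq_mktuple => j.
  by rewrite in_cons; case: eqVneq.
have dx := IH (cu x) ur; have dv := IH (cu v) ur.
apply: (@is_derive_eq _ _ _ _ _ _ _ _ (is_deriveD dx (is_deriveM _ dv))).
rewrite scale0r add0r big_cons addrC -[X in X + _ = _]/(g v 0 * 1) mulr1.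
congr (_ + _).
  congr B; apply: eq_mktuple => j; rewrite scale0r addr0 /cu in_cons.
  by case: (eqVneq j i) => // ->; rewrite (negbTE ir).
rewrite !big_seq; apply: eq_bigr => l lr; congr B; apply: eq_mktuple => j.
rewrite /cu in_cons; case: (j == l) => //; case: eqVneq => //= _.
by case: ifP.
Qed.

End multilinear.

(** * Polarization and gradient of a symmetric form *)

Section symmetric.
Variables (R : realType) (d m : nat) (B : m.-tuple 'cV[R]_d -> R).
Local Notation V := 'cV[R]_d.
Hypotheses (mB : multilinear_form B) (sB : Defs.symmetric_form B).

Lemma symmetric_perm_eq (t1 t2 : m.-tuple V) :
  perm_eq t1 t2 -> B t1 = B t2.
Proof.
move=> /tuple_permP[s t1E]; rewrite -(sB t2 s); congr B.
exact: val_inj.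
Qed.

(** Inclusion-exclusion: the sum is the expansion of the product over all [i] of
    [1 + g i], whose factor is [0] outside [S] and [1] on [S]. *)
Lemma sum_supersets_sign (S : {set 'I_m}) :
  \sum_(I : {set 'I_m} | S \subset I) (-1) ^+ (m - #|I|)
  = (S == [set: 'I_m])%:R :> R.
Proof.
pose g i : R := if i \in S then 0 else -1.
have gE (I : {set 'I_m}) : \prod_i (if i \in I then 1 else g i) =
    if S \subset I then (-1) ^+ (m - #|I|) else 0.
  rewrite (bigID (mem I)) /= big1 ?mul1r => [|i ->//].
  case: ifPn => [SI|/subsetPn[i iS iI]].
    have -> : (m - #|I| = #|~: I|)%N.
      by rewrite [RHS]cardsCs finset.setCK card_ord.
    rewrite -prodr_const; apply: eq_big => i; first by rewrite inE.
    move=> iI; rewrite (negbTE iI).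
    by rewrite /g (negbTE (contra (fintype.subsetP SI i) iI)).
  by rewrite (bigD1 i) //= (negbTE iI) /g iS mul0r.
rewrite big_mkcond /=; under eq_bigr => I _ do rewrite -gE.
transitivity (\prod_i (1 + g i)); first by rewrite (bigA_distr _ _ _ g).
have [ST|SnT] := eqVneq S [set: 'I_m]%SET.
  by rewrite big1 // => i _; rewrite /g ST inE addr0.
have /subsetPn[i _ iS] : ~~ ([set: 'I_m]%SET \subset S).
  by rewrite finset.subTset.
by rewrite (bigD1 i) //= /g (negbTE iS) subrr mul0r.
Qed.

(** Expanding each [B (t_I, ..., t_I)] over choices [f] of indices in [I] and
    exchanging the sums, [sum_supersets_sign] keeps the surjective [f] alone.
    These are the [m!] permutations, on which [B] takes the same value. *)
Lemma polarization (k0 : 'I_m) (t : m.-tuple V) :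
  \sum_(I : {set 'I_m})
     (-1) ^+ (m - #|I|) * B [tuple \sum_(i in I) tnth t i | _ < m]
  = m`!%:R * B t.
Proof.
under eq_bigr => I _ do rewrite (multilinear_expansion mB k0) mulr_sumr.
rewrite (exchange_big_dep xpredT) //=.
have inner (f : {ffun 'I_m -> 'I_m}) :
    \sum_(I : {set 'I_m} | [forall j, f j \in I])
      (-1) ^+ (m - #|I|) * B [tuple tnth t (f j) | j < m]
    = if injectiveb f then B t else 0.
  rewrite -mulr_suml.
  rewrite (eq_bigl (fun I : {set 'I_m} => [set f j | j : 'I_m]%SET \subset I)).
    rewrite sum_supersets_sign.
    have -> : ([set f j | j : 'I_m]%SET == finset.setT) = injectiveb f.
      rewrite eqEcard finset.subsetT cardsT /=.
      apply/idP/injectiveP => [|inj].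
        move=> H; have /imset_injP inj : #|[set f j | j : 'I_m]%SET| == #|'I_m|.
          by rewrite eqn_leq H leq_imset_card.
        by move=> x y /inj; apply.
      by rewrite card_imset.
    case: ifP => [/injectiveP injf|]; last by rewrite mul0r.
    rewrite mul1r -(sB t (perm injf)); congr B; apply: eq_mktuple => j.
    by rewrite permE.
  move=> I; apply/forallP/fintype.subsetP => [fI _ /imsetP[j _ ->]|fI j]//.
  by apply: fI; exact: imset_f.
under eq_bigr do rewrite inner.
rewrite -big_mkcond sumr_const mulr_natl; congr (_ *+ _).
by rewrite -cardsE card_inj_ffuns !card_ord ffactnn.
Qed.

Variables (U : V -> R).
Hypothesis BU : forall x, B [tuple of nseq m x] = U x.

(** The [m] terms of the Leibniz rule coincide by symmetry. *)
Lemma derive_polar (i0 : 'I_m) (x v : V) :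
  'D_v U x = m%:R * B (upd_tuple [tuple x | _ < m] i0 v).
Proof.
have lineE s : B [tuple if j \in enum 'I_m then x + s *: v else 0 | j < m]
    = U (x + s *: v).
  rewrite -BU; congr B; apply: eq_from_tnth => j.
  by rewrite tnth_mktuple mem_enum tnth_nseq.
have := multilinear_is_derive mB x v (fun=> 0) (enum_uniq 'I_m).
under eq_fun do rewrite lineE.
move=> lineD; have /= dE := @derive_val _ _ _ _ _ _ _ lineD.
transitivity ('D_1 (fun s : R => U (x + s *: v)) 0).
  rewrite /derive; set q1 := (X in lim (X @ _)%classic).
  set q2 := (X in _ = lim (X @ _)%classic).
  suff -> : q1 = q2 by [].
  apply/funext => s; rewrite /q1 /q2 /= addr0 scale0r addr0 [s *: 1]mulr1.
  by rewrite [x + _]addrC.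
rewrite dE big_enum /=.
transitivity (\sum_(j < m) B (upd_tuple [tuple x | _ < m] i0 v)); last first.
  by rewrite sumr_const card_ord mulr_natl.
apply: eq_bigr => j _.
rewrite -(sB _ (tperm i0 j)); congr B; apply: eq_mktuple => i.
have tE : (tperm i0 j i == j) = (i == i0).
  by rewrite -[X in _ == X](tpermL i0 j) (inj_eq perm_inj).
by rewrite !tnth_mktuple mem_enum tE.
Qed.

Lemma gradient_polar (i0 : 'I_m) (x v : V) :
  ((gradient U x)^T *m v) ord0 ord0
  = m%:R * B (upd_tuple [tuple x | _ < m] i0 v).
Proof.
rewrite {2}[v]matrix_sum_delta.
under eq_bigr do rewrite big_ord1.
rewrite multilinear_sum// mulr_sumr mxE; apply: eq_bigr => i _.
by rewrite !mxE (derive_polar i0) multilinearZ// mulrC mulrCA.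
Qed.

End symmetric.

(** * The polarized gradient of a polar form *)

Section last_slot.
Variables (R : realType) (d k : nat) (B : (k + 2).-tuple 'cV[R]_d -> R).
Local Notation V := 'cV[R]_d.
Hypotheses (mB : multilinear_form B) (sB : Defs.symmetric_form B).

(** The default value of [nth] fills the last slot.  This stands for
    [rcons t v], whose size [k.+2] does not convert to [k + 2]. *)
Definition with_last (t : k.+1.-tuple V) (v : V) : (k + 2).-tuple V :=
  [tuple nth v t j | j < k + 2].

Fact last_slot_proof : (k.+1 < k + 2)%N.
Proof. by rewrite addn2. Qed.
Definition last_slot : 'I_(k + 2) := Ordinal last_slot_proof.

Lemma val_with_last (t : k.+1.-tuple V) (v : V) :
  with_last t v = rcons t v :> seq V.
Proof.
have /esym := mkseq_nth v (rcons t v); rewrite size_rcons size_tuple => ->.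
rewrite (_ : k.+2 = k + 2)%N ?addn2// /mkseq /= -val_enum_ord -map_comp.
apply: eq_map => j /=.
by rewrite nth_rcons_default.
Qed.

Lemma upd_last_slot (x v : V) :
  upd_tuple [tuple x | _ < k + 2] last_slot v = with_last [tuple x | _ < k.+1] v.
Proof.
apply: eq_from_tnth => j; rewrite !tnth_mktuple.
rewrite -[j == last_slot]/(nat_of_ord j == k.+1).
have [->|jk] := eqVneq; first by rewrite nth_default// size_tuple.
have jlt : (j < k.+1)%N.
  by rewrite ltn_neqAle jk -ltnS -[X in (_ < X)%N]addn2 ltn_ord.
by rewrite -(tnth_nth v _ (Ordinal jlt)) tnth_mktuple.
Qed.

Lemma with_last_upd (t : k.+1.-tuple V) (v u : V) (i : 'I_k.+1)
    (ik : (i < k + 2)%N) :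
  with_last (upd_tuple t i u) v = upd_tuple (with_last t v) (Ordinal ik) u.
Proof.
apply: eq_from_tnth => j; rewrite !tnth_mktuple.
rewrite -[j == Ordinal ik]/(nat_of_ord j == nat_of_ord i).
have [jlt|jge] := ltnP j k.+1; last first.
  rewrite !nth_default ?size_tuple//; case: eqVneq => // ji.
  by move: (ltn_ord i); rewrite -ji ltnNge jge.
have nthE (s : k.+1.-tuple V) : nth v s j = tnth s (Ordinal jlt).
  by rewrite (tnth_nth v).
by rewrite !nthE tnth_mktuple -val_eqE.
Qed.

Lemma with_last_multilinear (v : V) :
  multilinear_form (fun t => B (with_last t v)).
Proof.
move=> t i; have ik : (i < k + 2)%N by rewrite addn2 ltnW// ltnS ltn_ord.
by move=> c u w; rewrite !with_last_upd (mB (with_last t v) (Ordinal ik) c).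
Qed.

Lemma with_last_symmetric (v : V) :
  Defs.symmetric_form (fun t => B (with_last t v)).
Proof.
move=> t s; apply: (symmetric_perm_eq sB); rewrite !val_with_last.
by rewrite -!cats1 perm_cat2r; apply/tuple_permP; exists s.
Qed.

Variable U : V -> R.
Hypothesis BU : forall x, B [tuple of nseq (k + 2) x] = U x.

(** [polarization] for the form obtained by fixing the last argument to [v].  The
    empty index set, absent from the gradient, contributes a value at [0],
    which vanishes. *)
Lemma polarized_gradient_polar (t : k.+1.-tuple V) (v : V) :
  ((polarized_gradient U t)^T *m v) ord0 ord0 = (k + 2)%:R * B (with_last t v).
Proof.
pose C t := B (with_last t v).
have gC (x : V) : ((gradient U x)^T *m v) ord0 ord0 =
    (k + 2)%:R * C [tuple x | _ < k.+1].
  by rewrite (gradient_polar mB sB BU last_slot) upd_last_slot.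
pose c (I : {set 'I_k.+1}) : R := (-1) ^+ (k.+1 - #|I|) / (k.+1)`!%:R.
pose s (I : {set 'I_k.+1}) := \sum_(i in I) tnth t i.
have -> : polarized_gradient U t =
    \sum_(I : {set 'I_k.+1} | I != finset.set0) c I *: gradient U (s I).
  rewrite /polarized_gradient big_add1 /= big_mkord.
  (* a nonempty I of size m goes to the class m.-1 *)
  rewrite [RHS](partition_big (fun I : {set 'I_k.+1} => inord #|I|.-1 : 'I_k.+1)
    xpredT) //=.
  apply: eq_bigr => j _; apply: eq_big => [I|I /eqP Ij]; last by rewrite /c Ij.
  rewrite -cards_eq0 -val_eqE /=; case E : #|I| => [|a] //=.
  by rewrite inordK ?eqSS// -ltnS -E ltnS (leq_trans (max_card _))// card_ord.
rewrite raddf_sum mulmx_suml summxE.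
have term I : ((c I *: gradient U (s I))^T *m v) ord0 ord0 =
    (k + 2)%:R / k.+1`!%:R
    * ((-1) ^+ (k.+1 - #|I|) * C [tuple s I | _ < k.+1]).
  by rewrite linearZ -scalemxAl mxE gC /c; ring.
under eq_bigr do rewrite term.
rewrite -mulr_sumr.
have C0 : C [tuple s finset.set0 | _ < k.+1] = 0.
  have := multilinearZ (with_last_multilinear v) [tuple 0 | _ < k.+1] ord0 0 0.
  rewrite scale0r mul0r => <-; congr C; apply: eq_from_tnth => j.
  by rewrite !tnth_mktuple /s big_set0; case: eqP.
have := polarization (with_last_multilinear v) (with_last_symmetric v) ord0 t.
rewrite (bigD1 finset.set0) //= -/(C _) C0 mulr0 add0r => ->.
by rewrite mulrA divfK// pnatr_eq0 -lt0n fact_gt0.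
Qed.

End last_slot.

(** * Windows of the trajectory *)

Lemma val_window (T : Type) (x : nat -> T) (n m : nat) :
  window x n m = [seq x j | j <- iota n m] :> seq T.
Proof.
rewrite /window /= -[in RHS](addn0 n) iotaDl -map_comp -val_enum_ord -map_comp.
exact: eq_map.
Qed.

Section append_two.
Variables (R : realType) (d k : nat) (B : (k + 2).-tuple 'cV[R]_d -> R).
Local Notation V := 'cV[R]_d.
Hypotheses (mB : multilinear_form B) (sB : Defs.symmetric_form B).

Lemma upd_append2 (t : k.-tuple V) (a b c : V) :
  upd_tuple (append2 t a b) (last_slot k) c = append2 t a c.
Proof.
apply: eq_from_tnth => j; rewrite !tnth_mktuple !(tnth_nth c) /= !nth_cat.
rewrite -val_eqE /= size_tuple.
have [->|jk] := eqVneq; first by rewrite ltnNge leqnSn /= subSnn.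
case: ltnP => // kj; have -> : j = k :> nat; last by rewrite subnn.
apply/eqP; rewrite eqn_leq kj andbT -ltnS ltn_neqAle jk -ltnS.
by rewrite -[X in (_ < X)%N]addn2 ltn_ord.
Qed.

Lemma append2Z (t : k.-tuple V) (a b : V) (c : R) :
  B (append2 t a (c *: b)) = c * B (append2 t a b).
Proof.
rewrite -(upd_append2 t a 0 (c *: b)) -(upd_append2 t a 0 b).
exact: multilinearZ.
Qed.

Lemma append2B (t : k.-tuple V) (a b c : V) :
  B (append2 t a (b - c)) = B (append2 t a b) - B (append2 t a c).
Proof.
have -> : b - c = b + -1 *: c by rewrite scaleN1r.
rewrite -(upd_append2 t a 0 (b + _)) -(upd_append2 t a 0 b).
by rewrite -(upd_append2 t a 0 c) multilinearPZ// mulN1r.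
Qed.

Lemma append2C (t : k.-tuple V) (a b : V) :
  B (append2 t a b) = B (append2 t b a).
Proof.
apply: (symmetric_perm_eq sB); rewrite perm_cat2l.
by rewrite (perm_catC [:: a] [:: b]).
Qed.

(** Both lists are the [k + 1] points [x_n, ..., x_(n+k)] followed by another copy
    of [x_(n+k)], up to order. *)
Lemma append2_window_shift (x : nat -> V) (n : nat) :
  B (append2 (window x n.+1 k) (x (n + k)%N) (x n)) =
  B (append2 (window x n k) (x (n + k)%N) (x (n + k)%N)).
Proof.
apply: (symmetric_perm_eq sB); rewrite /= !val_window.
set y := x (n + k)%N.
have W : x n :: [seq x j | j <- iota n.+1 k] =
    [seq x j | j <- iota n k] ++ [:: y].
  by rewrite -[LHS]/[seq x j | j <- iota n k.+1] -(addn1 k) iotaD map_cat.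
rewrite perm_catC /= W -[[:: y; y]]/([:: y] ++ [:: y]) catA.
by rewrite -[y :: _]cat1s perm_catC.
Qed.

Lemma with_last_window (x : nat -> V) (n : nat) (v : V) :
  with_last (window x n k.+1) v = append2 (window x n k) (x (n + k)%N) v.
Proof.
apply: val_inj.
rewrite [LHS]val_with_last /= !val_window -(addn1 k) iotaD map_cat.
by rewrite rcons_cat.
Qed.

End append_two.

Theorem corollary3 (R : realType) (d k : nat) (hk : (1 <= k)%N)
    (Q M A : 'M[R]_d) (hQ : Q^T = - Q) (hM : M^T = M) (hA : A = Q *m M)
    (h : R) (U : 'cV[R]_d -> R) (hU : homogeneous_polynomial (k + 2) U)
    (Ubar : (k + 2).-tuple 'cV[R]_d -> R) (hUbar : is_polar_form U Ubar)
    (x : nat -> 'cV[R]_d) (n : nat) (hx : ekahan_step k h A Q U x n) :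
  let H := discrete_energy M Ubar x in
  H n.+1 - H n =
    Ubar (append2 (window x n.+1 k) (x (n + k)%N) (x n.+1 - x n))
    + Ubar (append2 (window x n k) (x n) (x (n + k)%N - x (n + k.-1)%N))
    - 2 * Ubar (append2 (window x n k) (x (n + k)%N)
                  (k%:R^-1 *: (x (n + k)%N - x n))).
Proof.
rewrite /ekahan_step in hx.
move=> H; have [mU sU polU] := hUbar.
have kE : (n.+1 + k.-1 = n + k)%N by rewrite addSnnS prednK.
have k0 : k%:R != 0 :> R by rewrite pnatr_eq0 -lt0n.
pose w := window x n k; pose y := x (n + k)%N.
pose g v : R := Ubar (append2 w y v).
have quad_diff : quad M y - quad M (x n) = - 2 * ((k + 2)%:R * (g y - g (x n))).
  pose G := polarized_gradient U (window x n k.+1).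
  have Gg v : (G^T *m v) ord0 ord0 = (k + 2)%:R * g v.
    by rewrite (polarized_gradient_polar mU sU polU) with_last_window.
  have := exponential_step_energy (k%:R * h) (x n) G hQ hM.
  rewrite /= -hA -hx -/y !Gg => energy.
  by lra.
have sum_diff : \sum_(0 <= i < k) quad M (x (n.+1 + i)%N)
    - \sum_(0 <= i < k) quad M (x (n + i)%N) = quad M y - quad M (x n).
  rewrite -sumrB; under eq_bigr do rewrite addSnnS.
  by rewrite (telescope_sumr (fun i => quad M (x (n + i)%N)))// addn0.
rewrite /H /discrete_energy kE append2Z// !append2B//.
rewrite append2_window_shift// -/y -/w -!/(g _).
rewrite (append2C sU _ y (x n.+1)) (append2C sU w (x n) y) -/(g _).
have -> : \sum_(0 <= i < k) quad M (x (n.+1 + i)%N) =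
   \sum_(0 <= i < k) quad M (x (n + i)%N) + (quad M y - quad M (x n)).
  by rewrite -sum_diff; ring.
by rewrite quad_diff natrD; field.
Qed.
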